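(* Consider binary classical communication over a completely positive trace-preserving qubit channel $\mathcal{E}$, with measurement given by a pair of orthogonal projectors $\{\Pi_0,\Pi_1\}$, $\Pi_0+\Pi_1=I$, and performance measured by either of two functionals: the probability of correct decision $\mathrm{P}_c$ (equivalently, the error probability $\mathrm{P}_e=1-\mathrm{P}_c$, to be minimized) or the classical binary capacity $C_{bin}$. If the projectors $\{\Pi_0,\Pi_1\}$ have rank 1, then the optimal quantum states $\rho_0,\rho_1$ to transmit, for either functional, are orthogonal.
   Context: A qubit state is a $2\times2$ complex matrix $\rho=\rho^\dagger\ge 0$ with $\mathrm{tr}(\rho)=1$. Two states $\rho_0,\rho_1$ are orthogonal if $\rho_0\rho_1=0$; for a qubit this means that they are pure states represented by antipodal points of the Bloch sphere. A qubit channel is a linear completely positive trace-preserving map $\mathcal{E}$ taking qubit states to qubit states. A bit $x\in\{0,1\}$ with distribution $(p_0,p_1)$ is encoded in the state $\rho_x$, sent through $\mathcal{E}$, and measured with $\{\Pi_0,\Pi_1\}$, giving outcome $y\in\{0,1\}$. The associated classical binary channel has transition probabilities $p_{y|x}=\mathrm{tr}(\Pi_y\,\mathcal{E}(\rho_x))$. The probability of correct decision is $\mathrm{P}_c=p_{0|0}\,p_0+p_{1|1}\,p_1$, and the error probability is $\mathrm{P}_e=p_{1|0}\,p_0+p_{0|1}\,p_1=1-\mathrm{P}_c$. The classical binary capacity (for fixed input states and measurements) is $C_{bin}=\max_{(p_0,p_1)}H(x;y)$, where the mutual information is $$H(x;y)=\sum_{x,y\in\{0,1\}} p_{y|x}\,p_x\Big(\log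 p_{y|x}-\log\sum_{x'}p_{y|x'}p_{x'}\Big).$$ *)

(* Defs.v *)
From HB Require Import structures.
From mathcomp Require Export all_boot all_order all_algebra.
From mathcomp Require Export complex mxtens.
From mathcomp Require Export all_classical all_reals exp.

Set Implicit Arguments.
Unset Strict Implicit.
Unset Printing Implicit Defensive.

Import Order.TTheory GRing.Theory Num.Theory.
Local Open Scope classical_set_scope.
Local Open Scope sesquilinear_scope.
Local Open Scope complex_scope.
Local Open Scope ring_scope.

Section Qubits.
Variable R : realType.
Local Notation C := R[i].

(* On R[i], 0 <= z means that z is real and nonnegative. *)
Definition psdmx n (A : 'M[C]_n) : Prop :=
  A \is hermsymmx /\ forall v : 'cV[C]_n, 0 <= (v ^t* *m A *m v) 0 0.

Definition qubit_state (rho : 'M[C]_2) : Prop := psdmx rho /\ \tr rho = 1.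

Definition orthogonal_states (rho : 'I_2 -> 'M[C]_2) : Prop :=
  rho 0 *m rho 1 = 0.

(* (id_k (x) E) X: the index mxtens_index (i, a) of 'I_(k * 2) stands for the
   basis vector e_i (x) e_a, and E is applied to each 2 x 2 block of X. *)
Definition ampliation k (E : 'M[C]_2 -> 'M[C]_2) (X : 'M[C]_(k * 2)) :
    'M[C]_(k * 2) :=
  \matrix_(r, s)
    E (\matrix_(a, b) X (mxtens_index ((mxtens_unindex r).1, a))
                        (mxtens_index ((mxtens_unindex s).1, b)))
      (mxtens_unindex r).2 (mxtens_unindex s).2.

Definition completely_positive (E : 'M[C]_2 -> 'M[C]_2) : Prop :=
  forall k (X : 'M[C]_(k * 2)), psdmx X -> psdmx (ampliation E X).

Definition trace_preserving (E : 'M[C]_2 -> 'M[C]_2) : Prop :=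
  forall A, \tr (E A) = \tr A.

Definition qubit_channel (E : {linear 'M[C]_2 -> 'M[C]_2}) : Prop :=
  completely_positive E /\ trace_preserving E.

Definition projective_measurement (P : 'I_2 -> 'M[C]_2) : Prop :=
  [/\ forall y, P y \is hermsymmx,
      forall y, P y *m P y = P y,
      P 0 *m P 1 = 0
    & P 0 + P 1 = 1%:M].

(* The probability p_{y|x}. The trace is a real number of R[i] when E is a
   channel, P a measurement and rho x a state. *)
Definition transition (E : 'M[C]_2 -> 'M[C]_2) (P rho : 'I_2 -> 'M[C]_2)
    (y x : 'I_2) : R :=
  complex.Re (\tr (P y *m E (rho x))).

Definition distribution2 (p : 'I_2 -> R) : Prop :=
  (forall x, 0 <= p x) /\ p 0 + p 1 = 1.

Definition prob_correct (E : 'M[C]_2 -> 'M[C]_2) (P : 'I_2 -> 'M[C]_2)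
    (p : 'I_2 -> R) (rho : 'I_2 -> 'M[C]_2) : R :=
  transition E P rho 0 0 * p 0 + transition E P rho 1 1 * p 1.

Definition prob_error (E : 'M[C]_2 -> 'M[C]_2) (P : 'I_2 -> 'M[C]_2)
    (p : 'I_2 -> R) (rho : 'I_2 -> 'M[C]_2) : R :=
  transition E P rho 1 0 * p 0 + transition E P rho 0 1 * p 1.

Definition log (b x : R) : R := ln x / ln b.

(* W y x = p_{y|x}. Since ln 0 = 0, the terms with p_{y|x} p_x = 0 vanish, as
   in the convention 0 log 0 = 0; in the other terms both logarithms have a
   positive argument. *)
Definition mutual_information (b : R) (W : 'I_2 -> 'I_2 -> R)
    (p : 'I_2 -> R) : R :=
  \sum_(x < 2) \sum_(y < 2)
    W y x * p x * (log b (W y x) - log b (\sum_(x' < 2) W y x' * p x')).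

(* For a stochastic W the supremum is a maximum: the mutual information is
   continuous on the compact set of distributions. *)
Definition binary_capacity (b : R) (E : 'M[C]_2 -> 'M[C]_2)
    (P rho : 'I_2 -> 'M[C]_2) : R :=
  sup [set mutual_information b (transition E P rho) p
      | p in [set p | distribution2 p]].

Definition maximizing_states (F : ('I_2 -> 'M[C]_2) -> R)
    (rho : 'I_2 -> 'M[C]_2) : Prop :=
  (forall x, qubit_state (rho x)) /\
  forall sigma : 'I_2 -> 'M[C]_2,
    (forall x, qubit_state (sigma x)) -> F sigma <= F rho.

Definition minimizing_states (F : ('I_2 -> 'M[C]_2) -> R)
    (rho : 'I_2 -> 'M[C]_2) : Prop :=
  (forall x, qubit_state (rho x)) /\
  forall sigma : 'I_2 -> 'M[C]_2,
    (forall x, qubit_state (sigma x)) -> F rho <= F sigma.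

(* The outcome distribution is not the same for all input states. When it is
   (e.g. for a completely depolarizing channel), every pair of states is
   optimal for every functional of the transition probabilities. *)
Definition informative (E : 'M[C]_2 -> 'M[C]_2) (P : 'I_2 -> 'M[C]_2) : Prop :=
  exists sigma : 'I_2 -> 'M[C]_2, (forall x, qubit_state (sigma x)) /\
    exists y, transition E P sigma y 0 <> transition E P sigma y 1.

End Qubits.

(* Main.v *)
(* The Bloch ball parametrizes the qubit states, and p_{0|x} is an affine
   function of the Bloch vector of rho_x. Hence p_{0|x} ranges over an interval
   [m, M] whose endpoints are reached at antipodal points of the Bloch sphere,
   and only there when m < M. Each functional is maximal when {p_{0|0}, p_{0|1}}
   = {M, m}: this is clear for P_c. For the capacity, any other channel with
   parameters in [m, M] is the extremal channel preceded by a randomization of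
   its input, which strictly decreases the mutual information at an interior
   input distribution by strict concavity of the binary entropy; as the capacity
   is attained, it strictly decreases too. *)
Require Import Defs.
From mathcomp Require Import topology normedtype derive realfun ring lra.
Import Order.TTheory GRing.Theory Num.Theory.
Import numFieldNormedType.Exports.
Local Open Scope classical_set_scope.
Local Open Scope sesquilinear_scope.
Local Open Scope complex_scope.
Local Open Scope ring_scope.

Set Implicit Arguments.
Unset Strict Implicit.
Unset Printing Implicit Defensive.

(** * Entropy and mutual information of classical binary channels *)

Section Entropy.
Variable R : realType.
Implicit Types a b p q t x y z m M : R.

Definition xlnx x := x * ln x.

Lemma ln_ltB1 x : 0 < x -> x != 1 -> ln x < x - 1.
Proof.
move=> x0 x1.
have /expR_gt1Dx : ln x != 0 by rewrite ln_eq0.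
by rewrite lnK ?posrE // => h; lra.
Qed.

(** The left side of the inequality is the tangent of [xlnx] at [z]; the bound is $\ln(z/x) < z/x -
    1$ multiplied by $x$. Stated this way it also covers $x = 0$, where [xlnx] is not
    differentiable. *)
Lemma xlnx_gt_tangent x z : 0 <= x -> 0 < z -> x != z ->
  x * ln z + x - z < xlnx x.
Proof.
rewrite le_eqVlt => /predU1P[<- z0 _|x0 z0 xz]; first by rewrite /xlnx !mul0r; lra.
have zx0 : 0 < z / x by rewrite divr_gt0.
have zx1 : z / x != 1.
  by apply: contra xz => /eqP h; rewrite eq_sym -(divfK (lt0r_neq0 x0) z) h mul1r.
have := ln_ltB1 zx0 zx1; rewrite ln_div ?posrE // -(ltr_pM2l x0) /xlnx.
rewrite [x * (z / x - 1)](_ : _ = z - x); last by field; lra.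
by lra.
Qed.

(** The tangent at the mixture [z] lies strictly below [xlnx] at [x] and at [y], and the average of
    its values there is [xlnx z]. *)
Lemma xlnx_strict_convex t x y : 0 < t < 1 -> 0 <= x -> 0 <= y -> x != y ->
  xlnx (t * x + (1 - t) * y) < t * xlnx x + (1 - t) * xlnx y.
Proof.
move=> /andP[t0 t1] x0 y0 xy.
set z := t * x + (1 - t) * y.
have zx : x != z.
  apply: contra xy => /eqP xz; rewrite -subr_eq0; apply/eqP.
  have /eqP : (1 - t) * (x - y) = 0 by rewrite /z in xz; lra.
  by rewrite mulf_eq0 => /orP[/eqP|/eqP //]; lra.
have zy : y != z.
  apply: contra xy => /eqP yz; rewrite -subr_eq0; apply/eqP.
  have /eqP : t * (x - y) = 0 by rewrite /z in yz; lra.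
  by rewrite mulf_eq0 => /orP[/eqP|/eqP //]; lra.
(* The tangent needs a positive base point: [x] and [y] differ, so they cannot both vanish. *)
have z0 : 0 < z.
  have hx : 0 <= t * x by rewrite mulr_ge0 // ltW.
  have hy : 0 <= (1 - t) * y by rewrite mulr_ge0 // subr_ge0 ltW.
  rewrite lt_neqAle addr_ge0 // andbT eq_sym.
  apply: contra xy; rewrite paddr_eq0 // !mulf_eq0 => /andP[].
  rewrite gt_eqF //= => /eqP ->; rewrite gt_eqF ?subr_gt0 //= eq_sym.
  by [].
have := xlnx_gt_tangent x0 z0 zx; rewrite -(ltr_pM2l t0) => h1.
have := xlnx_gt_tangent y0 z0 zy.
rewrite -(ltr_pM2l (_ : 0 < 1 - t)) ?subr_gt0 // => h2.
have -> : xlnx z = t * (x * ln z + x - z) + (1 - t) * (y * ln z + y - z).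
  by rewrite /xlnx /z; ring.
exact: ltrD.
Qed.

(** This gives continuity of [xlnx] at 0. With $s = \sqrt{x}$, $-\ln x = 2\ln(1/s) < 2/s$, and
    multiplying by $x = s^2$ gives the bound; for $x \le 0$ the default value [ln x = 0] applies. *)
Lemma normr_xlnx_le x : x <= 1 -> `|xlnx x| <= 2 * Num.sqrt `|x|.
Proof.
move=> x1; rewrite /xlnx; have [x0|x0] := leP x 0.
  by rewrite ln0 // mulr0 normr0 mulr_ge0 // sqrtr_ge0.
have s0 : 0 < Num.sqrt x by rewrite sqrtr_gt0.
rewrite (gtr0_norm x0) ler0_norm; last first.
  by rewrite mulr_ge0_le0 ?ln_le0 // ltW.
have := ln_sublinear (_ : 0 < (Num.sqrt x)^-1); rewrite invr_gt0 => /(_ s0).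
rewrite lnV ?posrE // -(ltr_pM2l x0) => h.
have e : x * (Num.sqrt x)^-1 = Num.sqrt x.
  by rewrite -{1}(sqr_sqrtr (ltW x0)) expr2 mulfK // lt0r_neq0.
rewrite e in h.
have -> : ln x = 2 * ln (Num.sqrt x).
  by rewrite -{1}(sqr_sqrtr (ltW x0)) lnXn // mulr_natl.
lra.
Qed.

Lemma continuous_xlnx : continuous xlnx.
Proof.
move=> x; have [x0|x0|->] := ltgtP x 0.
- have : (fun=> 0) y @[y --> x] --> xlnx x.
    by rewrite /xlnx ln0 ?mulr0 1?ltW //; apply: cvg_cst.
  apply: cvg_trans; apply: near_eq_cvg; near=> y.
  by rewrite /xlnx ln0 ?mulr0 //; apply/ltW; near: y; exact: lt_nbhsl.
- by apply: cvgM; [exact: cvg_id | exact: continuous_ln].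
- rewrite /continuous_at {2}/xlnx mul0r.
  apply/norm_cvg0P.
  apply: (@squeeze_cvgr _ _ _ _ (fun=> 0) (fun y => 2 * Num.sqrt `|y|)).
  + near=> y; rewrite normr_ge0 normr_xlnx_le //.
    by apply/ltW; near: y; exact: lt_nbhsl.
  + exact: cvg_cst.
  + have : 2 * Num.sqrt `|y| @[y --> (0 : R)] --> 2 * Num.sqrt `|0 : R|.
      apply: cvgM; first exact: cvg_cst.
      apply: (@continuous_comp _ _ _ (fun y : R => `|y|) Num.sqrt).
        exact: norm_continuous.
      exact: sqrt_continuous.
    by rewrite normr0 sqrtr0 mulr0.
Unshelve. all: by end_near. Qed.

(* The negative of the binary entropy, in nats. *)
Definition nentropy q := xlnx q + xlnx (1 - q).

Lemma continuous_nentropy : continuous nentropy.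
Proof.
move=> q; apply: cvgD; first exact: continuous_xlnx.
apply: (@continuous_comp _ _ _ (fun y : R => 1 - y) xlnx).
  by apply: cvgB; [exact: cvg_cst | exact: cvg_id].
exact: continuous_xlnx.
Qed.

Lemma nentropy_strict_convex t a b : 0 < t < 1 -> 0 <= a <= 1 -> 0 <= b <= 1 ->
  a != b -> nentropy (t * a + (1 - t) * b) < t * nentropy a + (1 - t) * nentropy b.
Proof.
move=> t01 /andP[a0 a1] /andP[b0 b1] ab; rewrite /nentropy.
have h1 := xlnx_strict_convex t01 a0 b0 ab.
have := @xlnx_strict_convex t (1 - a) (1 - b) t01.
rewrite !subr_ge0 => /(_ a1 b1); rewrite (inj_eq (addrI 1)) eqr_opp => /(_ ab).
have -> : t * (1 - a) + (1 - t) * (1 - b) = 1 - (t * a + (1 - t) * b) by ring.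
by lra.
Qed.

Lemma nentropy_convex t a b : 0 <= t <= 1 -> 0 <= a <= 1 -> 0 <= b <= 1 ->
  nentropy (t * a + (1 - t) * b) <= t * nentropy a + (1 - t) * nentropy b.
Proof.
move=> /andP[t0 t1] a01 b01.
have [->|tn0] := eqVneq t 0; first by rewrite !mul0r !subr0 !mul1r !add0r.
have [->|tn1] := eqVneq t 1; first by rewrite subrr !mul0r !mul1r !addr0.
have [->|ab] := eqVneq a b; first by rewrite -!mulrDl !subrKC !mul1r.
by apply/ltW/nentropy_strict_convex => //; rewrite !lt_neqAle eq_sym tn0 t0 tn1.
Qed.

(* The mutual information, in nats, of the binary channel with
   p_{0|0} = a and p_{0|1} = b when the input distribution is (t, 1 - t). *)
Definition information t a b :=
  t * nentropy a + (1 - t) * nentropy b - nentropy (t * a + (1 - t) * b).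

Lemma information_gt0 t a b : 0 < t < 1 -> 0 <= a <= 1 -> 0 <= b <= 1 ->
  a != b -> 0 < information t a b.
Proof. by move=> *; rewrite subr_gt0 nentropy_strict_convex. Qed.

Lemma exists_information_gt0 a b : 0 <= a <= 1 -> 0 <= b <= 1 -> a != b ->
  exists2 t, 0 <= t <= 1 & 0 < information t a b.
Proof. by move=> *; exists (1 / 2); [lra | apply: information_gt0 => //; lra]. Qed.

Lemma informationxx t a : information t a a = 0.
Proof. by rewrite /information -!mulrDl subrKC !mul1r subrr. Qed.

Lemma information0 a b : information 0 a b = 0.
Proof. by rewrite /information !mul0r !subr0 !mul1r !add0r subrr. Qed.

Lemma information1 a b : information 1 a b = 0.
Proof. by rewrite /information subrr !mul0r !mul1r !addr0 subrr. Qed.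

(** Continuity on the compact interval $[0,1]$. Attainment is what later turns strict inequalities
    at one input distribution into strict inequalities between capacities. *)
Lemma information_max a b : exists2 t, 0 <= t <= 1 &
  forall s, 0 <= s <= 1 -> information s a b <= information t a b.
Proof.
have cf : continuous (fun t => information t a b).
  move=> t; apply: cvgB.
    apply: cvgD; apply: cvgM; try exact: cvg_cst; try exact: cvg_id.
    by apply: cvgB; [exact: cvg_cst | exact: cvg_id].
  apply: (@continuous_comp _ _ _ (fun t => t * a + (1 - t) * b) nentropy).
    apply: cvgD; apply: cvgM; try exact: cvg_cst; try exact: cvg_id.
    by apply: cvgB; [exact: cvg_cst | exact: cvg_id].
  exact: continuous_nentropy.
have [t] := EVT_max (ler01 : 0 <= 1 :> R) (continuous_subspaceT cf).
by rewrite in_itv /= => t01 tmax; exists t.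
Qed.

(* The channel with parameters a, b is the channel with parameters M, m
   preceded by a randomization of its input. *)
Lemma information_preprocess m M t a b : 0 <= m <= 1 -> 0 <= M <= 1 ->
  m <= a <= M -> m <= b <= M -> 0 <= t <= 1 ->
  exists2 s, 0 <= s <= 1 & information t a b <= information s M m /\
    (information t a b = information s M m -> 0 < information t a b ->
     (a = M /\ b = m) \/ (a = m /\ b = M)).
Proof.
move=> m01 M01 /andP[ma aM] /andP[mb bM] /andP[t0 t1].
have [mM|mM] := eqVneq m M.
  exists t; first by rewrite t0.
  have -> : a = M by lra. have -> : b = M by lra. rewrite mM; split => //.
  by rewrite informationxx ltxx.
have d0 : 0 < M - m by rewrite subr_gt0 lt_neqAle mM; lra.
(* [l q] is the weight of [M] in [q] as a mixture of [M] and [m], that is, the probability that the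
   randomization selects the input with parameter [M]. *)
pose l q := (q - m) / (M - m).
have lE q : q = l q * M + (1 - l q) * m by rewrite /l; field; lra.
have l01 q : m <= q <= M -> 0 <= l q <= 1.
  move=> /andP[h1 h2]; rewrite /l ler_pdivrMr // mul1r divr_ge0; lra.
have /andP[la0 la1] : 0 <= l a <= 1 by rewrite l01 // ma.
have /andP[lb0 lb1] : 0 <= l b <= 1 by rewrite l01 // mb.
(* The convexity gap of [nentropy] at [q]: the information lost by randomizing, zero only at the
   endpoints. *)
pose loss q := l q * nentropy M + (1 - l q) * nentropy m - nentropy q.
have loss_ge0 q : m <= q <= M -> 0 <= loss q.
  by move=> /l01 h; rewrite subr_ge0 {1}(lE q) nentropy_convex.
have loss_gt0 q : m <= q <= M -> q != m -> q != M -> 0 < loss q.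
  move=> h qm qM; rewrite subr_gt0 {1}(lE q) nentropy_strict_convex // 1?eq_sym //.
  have /andP[h0 h1] := l01 _ h; rewrite !lt_neqAle h0 h1 !andbT eq_sym.
  apply/andP; split; [apply: contra qm | apply: contra qM] => /eqP e; apply/eqP;
    by rewrite (lE q) e; ring.
have la := loss_ge0 a; have lb := loss_ge0 b.
rewrite ma aM in la; rewrite mb bM in lb; move: la lb => /(_ isT) la /(_ isT) lb.
(* The input distribution of the extremal channel after the randomization. *)
exists (t * l a + (1 - t) * l b).
  by nra.
(* Both channels have the same output distribution, so only the conditional entropies differ. *)
have E : information (t * l a + (1 - t) * l b) M m - information t a b =
    t * loss a + (1 - t) * loss b.
  rewrite /information.
  have -> : (t * l a + (1 - t) * l b) * M + (1 - (t * l a + (1 - t) * l b)) * m =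
      t * a + (1 - t) * b by rewrite [in RHS](lE a) [in RHS](lE b); ring.
  by rewrite /loss; ring.
have ha : 0 <= t * loss a by rewrite mulr_ge0.
have hb : 0 <= (1 - t) * loss b by rewrite mulr_ge0 // subr_ge0.
split; first by rewrite -subr_ge0 E addr_ge0.
move=> eqI pos.
(* Positive information forces an interior [t] and [a != b]. Both losses then carry positive weight
   and must vanish, so [a] and [b] are distinct endpoints. *)
have tn0 : t != 0 by apply: contraL pos => /eqP ->; rewrite information0 ltxx.
have tn1 : 1 - t != 0.
  by apply: contraL pos; rewrite subr_eq0 => /eqP <-; rewrite information1 ltxx.
have ab : a != b by apply: contraL pos => /eqP ->; rewrite informationxx ltxx.
have /eqP : t * loss a + (1 - t) * loss b = 0 by rewrite -E eqI subrr.
rewrite paddr_eq0 // !mulf_eq0 (negPf tn0) (negPf tn1) /= => /andP[a0 b0].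
have em q : m <= q <= M -> loss q == 0 -> q = m \/ q = M.
  move=> h h0; have [->|qm] := eqVneq q m; first by left.
  have [->|qM] := eqVneq q M; first by right.
  by have := loss_gt0 _ h qm qM; rewrite (eqP h0) ltxx.
have ea : a = m \/ a = M by apply: em => //; rewrite ma.
have eb : b = m \/ b = M by apply: em => //; rewrite mb.
by move: ab; case: ea => ->; case: eb => ->; rewrite ?eqxx //; [right | left].
Qed.

End Entropy.

(** * Qubit states as points of the Bloch ball *)

Section QubitStates.
Variable R : realType.
Local Notation C := R[i].

Lemma ord2P (P : 'I_2 -> Prop) : P 0 -> P 1 -> forall i, P i.
Proof.
move=> P0 P1 [[|[|//]] h]; first by rewrite (_ : Ordinal h = 0) //; apply: val_inj.
by rewrite (_ : Ordinal h = 1) //; apply: val_inj.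
Qed.

Lemma sum_ord2 (V : nmodType) (F : 'I_2 -> V) : \sum_(i < 2) F i = F 0 + F 1.
Proof.
by rewrite big_ord_recl big_ord1; congr (_ + F _); apply: val_inj.
Qed.

(** The criterion by diagonal entries and determinant, in real coordinates so that later goals
    become real arithmetic. *)
Lemma psdmx2P (A : 'M[C]_2) : psdmx A <->
  exists a d x y : R, [/\ 0 <= a, 0 <= d, x ^+ 2 + y ^+ 2 <= a * d &
    [/\ A 0 0 = a%:C, A 1 1 = d%:C, A 0 1 = x +i* y & A 1 0 = x -i* y]].
Proof.
have form (v : 'cV[C]_2) : (v ^t* *m A *m v) 0 0 =
    (A 0 0 * (v 0 0)^* + A 1 0 * (v 1 0)^*) * v 0 0 +
    (A 0 1 * (v 0 0)^* + A 1 1 * (v 1 0)^*) * v 1 0.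
  by rewrite mxE sum_ord2 !mxE !sum_ord2 !mxE ![_^* * _]mulrC.
split=> [[/is_hermitianmxP hA pos]|[a [d [x [y [a0 d0 det0 [e00 e11 e01 e10]]]]]]].
  have hE i j : A i j = (A j i)^* by rewrite {1}hA expr0 scale1r !mxE.
  move: (hE 0 0) (hE 1 1) (hE 1 0).
  case e00: (A 0 0) => [a a']; case e11: (A 1 1) => [d d'].
  case e01: (A 0 1) => [x y]; case e10: (A 1 0) => [x' y'].
  move=> [ea'] [ed'] [ex ey].
  have Re_ge0 (z : C) : 0 <= z -> 0 <= complex.Re z by rewrite lecE => /andP[].
  (* The basis vectors give $a, d \ge 0$; the next two vectors give $a \det A \ge 0$ and $d \det A
     \ge 0$. The last one settles $a = d = 0$, where the form equals $-2(x^2 + y^2)$. *)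
  have /Re_ge0 := pos (\col_i if i == 0 then 1 else 0).
  have /Re_ge0 := pos (\col_i if i == 0 then 0 else 1).
  have /Re_ge0 := pos (\col_i if i == 0 then - (x +i* y) else a%:C).
  have /Re_ge0 := pos (\col_i if i == 0 then d%:C else - (x' +i* y')).
  have /Re_ge0 := pos (\col_i if i == 0 then - (x +i* y) else 1).
  rewrite !form !mxE /= e00 e01 e10 e11 ex ey /=.
  move=> h1 h2 h3 h4 h5; exists a, d, x, y.
  have a0 : 0 <= a by lra.
  have d0 : 0 <= d by lra.
  have a'0 : a' = 0 by lra.
  have d'0 : d' = 0 by lra.
  rewrite a'0 d'0; split => //.
  have aD : 0 <= a * (a * d - (x ^+ 2 + y ^+ 2)) by rewrite a'0 in h3; lra.
  have dD : 0 <= d * (a * d - (x ^+ 2 + y ^+ 2)) by rewrite d'0 in h2; lra.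
  rewrite -subr_ge0.
  move: a0; rewrite le_eqVlt => /predU1P[az|a_gt0]; last by rewrite -(pmulr_rge0 _ a_gt0).
  move: d0; rewrite le_eqVlt => /predU1P[dz|d_gt0]; last by rewrite -(pmulr_rge0 _ d_gt0).
  by rewrite -az -dz in h1 *; lra.
split.
  apply/is_hermitianmxP; rewrite expr0 scale1r; apply/matrixP.
  by apply: ord2P; apply: ord2P; rewrite !mxE ?e00 ?e01 ?e10 ?e11 /=; apply/eqP; rewrite eq_complex /= ?oppr0 ?opprK !eqxx.
move=> v; rewrite form e00 e01 e10 e11 lecE.
case: (v 0 0) => p q; case: (v 1 0) => r s /=.
apply/andP; split; first by apply/eqP; ring.
set Q := (X in 0 <= X).
(* Completing the square: $aQ = |a v_0 + A_{01} v_1|^2 + \det A \, |v_1|^2$. *)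
have aQ : a * Q = (a * p + x * r - y * s) ^+ 2 + (a * q + x * s + y * r) ^+ 2 +
    (a * d - (x ^+ 2 + y ^+ 2)) * (r ^+ 2 + s ^+ 2) by rewrite /Q; ring.
have [a_gt0|a_le0] := ltP 0 a.
  rewrite -(pmulr_rge0 _ a_gt0) aQ !addr_ge0 ?sqr_ge0 // mulr_ge0 ?subr_ge0 //.
  by rewrite addr_ge0 ?sqr_ge0.
have az : a = 0 by lra.
have x0 : x = 0 by nra.
have y0 : y = 0 by nra.
have -> : Q = d * (r ^+ 2 + s ^+ 2) by rewrite /Q az x0 y0; ring.
by rewrite mulr_ge0 // addr_ge0 ?sqr_ge0.
Qed.

(* (I + x X + y Y + z Z) / 2 in terms of the Pauli matrices. *)
Definition bloch (x y z : R) : 'M[C]_2 := \matrix_(i, j)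
  if i == 0 then if j == 0 then ((1 + z) / 2)%:C else (x / 2) -i* (y / 2)
  else if j == 0 then (x / 2) +i* (y / 2) else ((1 - z) / 2)%:C.

Lemma bloch_state x y z : x ^+ 2 + y ^+ 2 + z ^+ 2 <= 1 ->
  qubit_state (bloch x y z).
Proof.
move=> r1; split.
  apply/psdmx2P; exists ((1 + z) / 2), ((1 - z) / 2), (x / 2), (- (y / 2)).
  have zz : z ^+ 2 <= 1 by nra.
  split; [nra | nra | nra |].
  by rewrite !mxE /= opprK.
rewrite /mxtrace sum_ord2 !mxE /=.
by apply/eqP; rewrite eq_complex /=; apply/andP; split; apply/eqP; lra.
Qed.

Lemma qubit_state_bloch rho : qubit_state rho ->
  exists x y z, x ^+ 2 + y ^+ 2 + z ^+ 2 <= 1 /\ rho = bloch x y z.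
Proof.
move=> [/psdmx2P[a [d [x [y [a0 d0 det0 [e00 e11 e01 e10]]]]]] tr1].
have ad : a + d = 1.
  by move: tr1; rewrite /mxtrace sum_ord2 e00 e11 => -[].
exists (2 * x), (- (2 * y)), (a - d); split.
  have -> : d = 1 - a by lra.
  have dE : d = 1 - a by lra.
  by rewrite dE in det0; nra.
apply/matrixP; apply: ord2P; apply: ord2P;
  rewrite !mxE /= ?e00 ?e11 ?e01 ?e10; apply/eqP; rewrite eq_complex /=;
  by apply/andP; split; apply/eqP; lra.
Qed.

(** For a unit Bloch vector the first factor is a projector, and the second is its complement. *)
Lemma mul_bloch_antipodal x y z : x ^+ 2 + y ^+ 2 + z ^+ 2 = 1 ->
  bloch x y z *m bloch (- x) (- y) (- z) = 0.
Proof.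
move=> r1; have zz : z ^+ 2 = 1 - x ^+ 2 - y ^+ 2 by lra.
apply/matrixP; apply: ord2P; apply: ord2P; rewrite !mxE sum_ord2 !mxE /=;
  apply/eqP; rewrite eq_complex /=; apply/andP; split; apply/eqP; lra.
Qed.

Lemma bloch_affine (g : 'M[C]_2 -> R) :
  (forall A B, g (A + B) = g A + g B) ->
  (forall (c : R) A, g (c%:C *: A) = c * g A) ->
  exists a u v w, forall x y z, g (bloch x y z) = a + (u * x + v * y + w * z).
Proof.
move=> gD gZ.
exists (g (bloch 0 0 0)), (g (bloch 1 0 0) - g (bloch 0 0 0)),
  (g (bloch 0 1 0) - g (bloch 0 0 0)), (g (bloch 0 0 1) - g (bloch 0 0 0)) => x y z.
have -> : bloch x y z = (1 - x - y - z)%:C *: bloch 0 0 0 + x%:C *: bloch 1 0 0 +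
    y%:C *: bloch 0 1 0 + z%:C *: bloch 0 0 1.
  apply/matrixP; apply: ord2P; apply: ord2P; rewrite !mxE /=;
  apply/eqP; rewrite eq_complex /=; apply/andP; split; apply/eqP; lra.
by rewrite !gD !gZ; ring.
Qed.

(** Cauchy-Schwarz with its equality case: the maximum is at the normalized coefficient vector. If
    that vector is 0, any unit vector serves and the uniqueness clause is vacuous. *)
Lemma affine_unit_ball_max (u v w : R) : exists x y z : R,
  x ^+ 2 + y ^+ 2 + z ^+ 2 = 1 /\
  forall x' y' z' : R, x' ^+ 2 + y' ^+ 2 + z' ^+ 2 <= 1 ->
    u * x' + v * y' + w * z' <= u * x + v * y + w * z /\
    (u * x' + v * y' + w * z' = u * x + v * y + w * z ->
     0 < u * x + v * y + w * z -> [/\ x' = x, y' = y & z' = z]).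
Proof.
pose N := Num.sqrt (u ^+ 2 + v ^+ 2 + w ^+ 2).
have NE : N ^+ 2 = u ^+ 2 + v ^+ 2 + w ^+ 2.
  by rewrite sqr_sqrtr // !addr_ge0 ?sqr_ge0.
have [N0|N0] := eqVneq N 0.
  rewrite N0 in NE.
  have [-> -> ->] : [/\ u = 0, v = 0 & w = 0] by split; nra.
  exists 0, 0, 1; split; first by lra.
  by move=> x' y' z' _; split; lra.
have {}N0 : 0 < N by rewrite lt_neqAle eq_sym N0 sqrtr_ge0.
exists (u / N), (v / N), (w / N).
have n1 : (u / N) ^+ 2 + (v / N) ^+ 2 + (w / N) ^+ 2 = 1.
  by rewrite !expr_div_n -!mulrDl -NE divff // expf_neq0 // gt_eqF.
split=> // x' y' z' r1.
have -> : u * (u / N) + v * (v / N) + w * (w / N) = N.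
  by rewrite !mulrA -!expr2 -!mulrDl -NE expr2 mulfK // gt_eqF.
have -> : u * x' + v * y' + w * z' =
    N * (u / N * x' + v / N * y' + w / N * z') by field; rewrite gt_eqF.
move: (u / N) (v / N) (w / N) n1 => x y z n1.
(* For $|r| = 1$ and $|r'| \le 1$, $|r' - r|^2 \ge 0$ gives $r \cdot r' \le 1$, and equality makes
   every squared coordinate difference vanish. *)
have sq := (sqr_ge0 (x' - x), sqr_ge0 (y' - y), sqr_ge0 (z' - z)).
split.
  rewrite -[leRHS]mulr1 ler_pM2l //.
  by have [[]] := sq; lra.
move=> e _.
have {}e : x * x' + y * y' + z * z' = 1.
  by apply: (mulfI (lt0r_neq0 N0)); rewrite e mulr1.
have [[sx sy] sz] := sq.
have [ex ey ez] : [/\ (x' - x) ^+ 2 = 0, (y' - y) ^+ 2 = 0 & (z' - z) ^+ 2 = 0].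
  by split; lra.
by split; apply/eqP; rewrite -subr_eq0 -sqrf_eq0; apply/eqP.
Qed.

Lemma orthogonal_extremal_states (g : 'M[C]_2 -> R) :
  (forall A B, g (A + B) = g A + g B) ->
  (forall (c : R) A, g (c%:C *: A) = c * g A) ->
  exists rM rm, [/\ qubit_state rM, qubit_state rm, rM *m rm = 0, rm *m rM = 0 &
    forall s, qubit_state s -> g rm <= g s <= g rM /\
      (g rm != g rM -> (g s = g rM -> s = rM) /\ (g s = g rm -> s = rm))].
Proof.
move=> gD gZ; have [a [u [v [w gE]]]] := bloch_affine gD gZ.
have [x [y [z [r1 opt]]]] := affine_unit_ball_max u v w.
exists (bloch x y z), (bloch (- x) (- y) (- z)); split.
- by apply: bloch_state; rewrite r1.
- by apply: bloch_state; rewrite !sqrrN r1.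
- exact: mul_bloch_antipodal.
- by rewrite -{2}[x]opprK -{2}[y]opprK -{2}[z]opprK mul_bloch_antipodal // !sqrrN.
move=> s /qubit_state_bloch[x' [y' [z' [r' ->]]]]; rewrite !gE.
have [leM eqM] := opt _ _ _ r'.
(* The minimum of the linear part is its maximum read at the opposite vector. *)
have := opt (- x') (- y') (- z'); rewrite !sqrrN => /(_ r')[lem eqm].
split; first by lra.
move=> ne; have pos : 0 < u * x + v * y + w * z.
  by rewrite lt_neqAle; apply/andP; split; [apply: contra ne => /eqP ne; apply/eqP|]; lra.
split=> e.
  by have [|//|-> -> ->] := eqM; first by lra.
have [|//|ex ey ez] := eqm; first by lra.
by rewrite -ex -ey -ez !opprK.
Qed.
End QubitStates.

(** * From qubit transmission to classical binary channels, and the optimal states *)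

Section Transmission.
Variable R : realType.
Local Notation C := R[i].

Lemma distribution2_bounds (p : 'I_2 -> R) : distribution2 p ->
  0 <= p 0 <= 1 /\ p 1 = 1 - p 0.
Proof. by move=> [p_ge0 p1]; have := (p_ge0 0, p_ge0 1) => -[h0 h1]; lra. Qed.

Lemma mutual_information_information b (W : 'I_2 -> 'I_2 -> R) p :
  (forall x, W 1 x = 1 - W 0 x) -> distribution2 p ->
  mutual_information b W p = information (p 0) (W 0 0) (W 0 1) / ln b.
Proof.
move=> W1 /distribution2_bounds[_ p1].
rewrite /mutual_information !sum_ord2 !W1 p1 /log /information /nentropy /xlnx.
have -> : (1 - W 0 0) * p 0 + (1 - W 0 1) * (1 - p 0) =
   1 - (W 0 0 * p 0 + W 0 1 * (1 - p 0)) by ring.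
rewrite ![_ * p 0]mulrC ![_ * (1 - p 0)]mulrC.
by ring.
Qed.

Lemma sup_mutual_information b (W : 'I_2 -> 'I_2 -> R) t :
  1 < b -> (forall x, W 1 x = 1 - W 0 x) -> 0 <= t <= 1 ->
  (forall s, 0 <= s <= 1 ->
    information s (W 0 0) (W 0 1) <= information t (W 0 0) (W 0 1)) ->
  sup [set mutual_information b W p | p in [set p | distribution2 p]] =
  information t (W 0 0) (W 0 1) / ln b.
Proof.
move=> b1 W1 /andP[t0 t1] tmax; pose p (x : 'I_2) := if x == 0 then t else 1 - t.
have dp : distribution2 p.
  by split; [apply: ord2P; rewrite /p /= ?subr_ge0 | rewrite /p /= subrKC].
have pE : mutual_information b W p = information t (W 0 0) (W 0 1) / ln b.
  exact: mutual_information_information.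
have ub : ubound [set mutual_information b W p | p in [set p | distribution2 p]]
    (information t (W 0 0) (W 0 1) / ln b).
  move=> _ [q dq <-]; rewrite mutual_information_information //.
  rewrite ler_pM2r ?invr_gt0 ?ln_gt0 // tmax //.
  by have [] := distribution2_bounds dq.
apply/eqP; rewrite eq_le; apply/andP; split.
  by apply: ge_sup => //; exists (mutual_information b W p), p.
by apply: ub_le_sup; [exists (information t (W 0 0) (W 0 1) / ln b) | exists p].
Qed.

Lemma mxtens_unindex1 (r : 'I_(1 * 2)) : (mxtens_unindex r).2 = r.
Proof. by apply: val_inj; rewrite /= modn_small. Qed.

(** Complete positivity at [k = 1], where the ampliation is [E] itself because [1 * 2] computes to
    [2]. *)
Lemma channel_psdmx (E : {linear 'M[C]_2 -> 'M[C]_2}) A :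
  qubit_channel E -> psdmx A -> psdmx (E A).
Proof.
move=> [cpE _] /(cpE 1%N A).
rewrite (_ : @ampliation R 1 E A = (E A : 'M[C]_2)) //; apply/matrixP => i j; rewrite mxE.
rewrite !mxtens_unindex1; congr (E _ i j); apply/matrixP => a b; rewrite mxE.
congr (A _ _); by apply: val_inj; rewrite /= divn_small.
Qed.

(** $\mathrm{tr}(QA) = \mathrm{tr}(QAQ)$, and each diagonal entry of $QAQ$ is the form of $A$ at a
    column of $Q$. *)
Lemma mxtrace_proj_psdmx n (Q A : 'M[C]_n) : Q \is hermsymmx -> Q *m Q = Q ->
  psdmx A -> 0 <= \tr (Q *m A).
Proof.
move=> /is_hermitianmxP hQ QQ [_ A_ge0].
rewrite -QQ -mulmxA mxtrace_mulC.
apply: sumr_ge0 => i _.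
have -> : (Q *m A *m Q) i i = ((col i Q)^t* *m A *m col i Q) 0 0.
  rewrite !mxE; apply: eq_bigr => j _; rewrite !mxE; congr (_ * _).
  apply: eq_bigr => k _; rewrite !mxE; congr (_ * _).
  by rewrite {1}hQ expr0 scale1r !mxE.
exact: A_ge0.
Qed.

Section Measurement.
Variables (E : {linear 'M[C]_2 -> 'M[C]_2}) (P : 'I_2 -> 'M[C]_2).
Hypotheses (hE : qubit_channel E) (hP : projective_measurement P).

Lemma transition_ge0 rho y x : qubit_state (rho x) -> 0 <= transition E P rho y x.
Proof.
move=> [psd _]; have [hP1 hP2 _ _] := hP.
have := mxtrace_proj_psdmx (hP1 y) (hP2 y) (channel_psdmx hE psd).
by rewrite lecE => /andP[].
Qed.

Lemma transition1 rho x : qubit_state (rho x) ->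
  transition E P rho 1 x = 1 - transition E P rho 0 x.
Proof.
move=> [_ tr1]; have [_ trE] := hE; have [_ _ _ P1] := hP.
have : \tr (P 0 *m E (rho x)) + \tr (P 1 *m E (rho x)) = 1.
  by rewrite -mxtraceD -mulmxDl P1 mul1mx trE tr1.
by rewrite /transition => /(congr1 (@complex.Re R)); rewrite raddfD /= => <-; ring.
Qed.

Lemma transition_bounds rho x : qubit_state (rho x) ->
  0 <= transition E P rho 0 x <= 1.
Proof.
move=> hx; rewrite transition_ge0 //=.
by have := transition_ge0 1 hx; rewrite (transition1 hx) subr_ge0.
Qed.

Lemma informative0 : informative E P -> exists2 s : 'I_2 -> 'M[C]_2,
  forall x, qubit_state (s x) & transition E P s 0 0 != transition E P s 0 1.
Proof.
move=> [s [hs [y sy]]]; exists s => //; apply: contra_notN sy => /eqP e.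
move: y; apply: ord2P; first exact: e.
by rewrite (transition1 (hs 0)) (transition1 (hs 1)) e.
Qed.

Lemma prob_errorE p rho : distribution2 p -> (forall x, qubit_state (rho x)) ->
  prob_error E P p rho = 1 - prob_correct E P p rho.
Proof.
move=> /distribution2_bounds[_ p1] hrho.
rewrite /prob_error /prob_correct (transition1 (hrho 0)) (transition1 (hrho 1)) p1.
by ring.
Qed.

Lemma minimizing_prob_error p rho : distribution2 p ->
  minimizing_states (prob_error E P p) rho <->
  maximizing_states (prob_correct E P p) rho.
Proof.
move=> dp; split=> -[hrho opt]; split; try exact: hrho; move=> s hs;
  have := opt s hs; rewrite (prob_errorE dp hs) (prob_errorE dp hrho);
  by rewrite lerD2l lerN2.
Qed.

Lemma extremal_transitions : exists rM rm,
  [/\ qubit_state rM, qubit_state rm, rM *m rm = 0, rm *m rM = 0 &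
   exists m M, [/\ 0 <= m <= 1, 0 <= M <= 1,
     forall rho x, rho x = rM -> transition E P rho 0 x = M,
     forall rho x, rho x = rm -> transition E P rho 0 x = m &
     forall rho x, qubit_state (rho x) ->
       m <= transition E P rho 0 x <= M /\
       (informative E P -> (transition E P rho 0 x = M -> rho x = rM) /\
                         (transition E P rho 0 x = m -> rho x = rm))]].
Proof.
pose g A := complex.Re (\tr (P 0 *m E A)).
have gD A B : g (A + B) = g A + g B by rewrite /g linearD mulmxDr mxtraceD raddfD.
have gZ (c : R) A : g (c%:C *: A) = c * g A.
  rewrite /g linearZ /= -scalemxAr mxtraceZ.
  by case: (\tr _) => u v /=; rewrite mul0r subr0.
have [rM [rm [hM hm Mm mM opt]]] := orthogonal_extremal_states gD gZ.
exists rM, rm; split => //; exists (g rm), (g rM); split.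
- exact: (@transition_bounds (fun=> rm) 0 hm).
- exact: (@transition_bounds (fun=> rM) 0 hM).
- by move=> rho x <-.
- by move=> rho x <-.
- move=> rho x hx; have [bnd eqs] := opt _ hx; split => // /informative0[s hs sne].
  (* If the two extreme values agreed, all states would give the same outcome probability, against
     informativeness. *)
  apply: eqs; apply: contra sne => /eqP e; apply/eqP.
  have gs y : transition E P s 0 y = g rm.
    have [/andP[h1 h2] _] := opt _ (hs y).
    by apply: le_anti; apply/andP; split; first rewrite e.
  exact: etrans (gs 0) (esym (gs 1)).
Qed.

Lemma binary_capacity_information b rho : 1 < b -> (forall x, qubit_state (rho x)) ->
  exists2 t, 0 <= t <= 1 &
    binary_capacity b E P rho =
      information t (transition E P rho 0 0) (transition E P rho 0 1) / ln b /\
    forall s, 0 <= s <= 1 ->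
      information s (transition E P rho 0 0) (transition E P rho 0 1) <=
      information t (transition E P rho 0 0) (transition E P rho 0 1).
Proof.
move=> b1 hrho.
have [t t01 tmax] := information_max (transition E P rho 0 0) (transition E P rho 0 1).
exists t => //; split => //; apply: sup_mutual_information => // x.
exact: transition1.
Qed.

Lemma prob_correct_maximizers p : distribution2 p ->
  (exists rho, maximizing_states (prob_correct E P p) rho /\
     orthogonal_states rho) /\
  (informative E P -> 0 < p 0 -> 0 < p 1 ->
     forall rho, maximizing_states (prob_correct E P p) rho ->
       orthogonal_states rho).
Proof.
move=> [p_ge0 _].
have [rM [rm [hM hm Mm mM [m [M [m0 M1 eM em opt]]]]]] := extremal_transitions.
pose opt_rho (x : 'I_2) := if x == 0 then rM else rm.
have opt_state x : qubit_state (opt_rho x) by rewrite /opt_rho; case: ifP.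
have optE : prob_correct E P p opt_rho = M * p 0 + (1 - m) * p 1.
  by rewrite /prob_correct transition1 // (eM opt_rho) // (em opt_rho).
split.
  exists opt_rho; split; last exact: Mm.
  split; first exact: opt_state.
  move=> s hs; rewrite optE /prob_correct transition1 //.
  have [/andP[_ s0] _] := opt s 0 (hs 0); have [/andP[s1 _] _] := opt s 1 (hs 1).
  by rewrite lerD // ler_wpM2r // lerD2l lerN2.
move=> inf p0 p1 rho [hrho max_rho]; have := max_rho _ opt_state.
rewrite optE /prob_correct transition1 //.
have [/andP[_ s0] /(_ inf)[eqM _]] := opt rho 0 (hrho 0).
have [/andP[s1 _] /(_ inf)[_ eqm]] := opt rho 1 (hrho 1).
(* Each term of the sum is at most its optimal value; with positive priors, optimality of the sum
   makes both terms optimal, which singles out [rM] and [rm]. *)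
move=> le; rewrite /orthogonal_states eqM ?eqm //.
  by apply: (mulIf (lt0r_neq0 p1)); nra.
by apply: (mulIf (lt0r_neq0 p0)); nra.
Qed.

Lemma binary_capacity_maximizers b : 1 < b ->
  (exists rho, maximizing_states (binary_capacity b E P) rho /\
     orthogonal_states rho) /\
  (informative E P ->
     forall rho, maximizing_states (binary_capacity b E P) rho ->
       orthogonal_states rho).
Proof.
move=> b1; have lnb : 0 < (ln b)^-1 by rewrite invr_gt0 ln_gt0.
have [rM [rm [hM hm Mm mM [m [M [m0 M1 eM em opt]]]]]] := extremal_transitions.
pose opt_rho (x : 'I_2) := if x == 0 then rM else rm.
have opt_state x : qubit_state (opt_rho x) by rewrite /opt_rho; case: ifP.
have [T T01 []] := binary_capacity_information b1 opt_state.
rewrite (eM opt_rho) // (em opt_rho) // => optE Tmax.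
split.
  exists opt_rho; split; last exact: Mm.
  split; first exact: opt_state.
  move=> s hs; have [t t01 [-> _]] := binary_capacity_information b1 hs.
  have [s0 _] := opt s 0 (hs 0); have [s1 _] := opt s 1 (hs 1).
  have [u u01 [le _]] := information_preprocess m0 M1 s0 s1 t01.
  by rewrite optE ler_pM2r // (le_trans le) // Tmax.
move=> inf rho [hrho max_rho]; have := max_rho _ opt_state.
have [t t01 [-> _]] := binary_capacity_information b1 hrho.
rewrite optE ler_pM2r // => leT.
have [s0 /(_ inf)[eqM0 eqm0]] := opt rho 0 (hrho 0).
have [s1 /(_ inf)[eqM1 eqm1]] := opt rho 1 (hrho 1).
have [u u01 [le eqI]] := information_preprocess m0 M1 s0 s1 t01.
(* Informativeness separates the extreme parameters, so the optimal capacity is positive. *)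
have mM_neq : M != m.
  have [s hs] := informative0 inf; apply: contra => /eqP e; apply/eqP.
  have e0 x : transition E P s 0 x = m.
    have [/andP[h1 h2] _] := opt _ x (hs x).
    by apply: le_anti; rewrite h1 -{1}e h2.
  by rewrite !e0.
have pos : 0 < information T M m.
  have [r r01 /lt_le_trans] := exists_information_gt0 M1 m0 mM_neq.
  by apply; exact: Tmax.
(* The chain $I_T(M,m) \le I_t(\rho) \le I_u(M,m) \le I_T(M,m)$ collapses to equalities. The two
   remaining cases are the extremal pair and its swap, since capacity ignores the labelling of
   inputs. *)
case: eqI => [||[/eqM0 r0 /eqm1 r1]|[/eqm0 r0 /eqM1 r1]].
- by apply/eqP; rewrite eq_le le /= (le_trans (Tmax _ u01)).
- exact: lt_le_trans leT.
- by rewrite /orthogonal_states r0 r1.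
- by rewrite /orthogonal_states r0 r1.
Qed.

End Measurement.
End Transmission.

Theorem corollary2 (R : realType)
    (E : {linear 'M[R[i]]_2 -> 'M[R[i]]_2}) (P : 'I_2 -> 'M[R[i]]_2)
    (hE : qubit_channel E) (hP : projective_measurement P)
    (rank1 : forall y, \rank (P y) = 1%N) :
  [/\ forall p : 'I_2 -> R, distribution2 p ->
        (exists rho, maximizing_states (prob_correct E P p) rho /\
           orthogonal_states rho) /\
        (informative E P -> 0 < p 0 -> 0 < p 1 ->
           forall rho, maximizing_states (prob_correct E P p) rho ->
             orthogonal_states rho),
      forall p : 'I_2 -> R, distribution2 p ->
        (exists rho, minimizing_states (prob_error E P p) rho /\
           orthogonal_states rho) /\
        (informative E P -> 0 < p 0 -> 0 < p 1 ->
           forall rho, minimizing_states (prob_error E P p) rho ->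
             orthogonal_states rho)
    & forall b : R, 1 < b ->
        (exists rho, maximizing_states (binary_capacity b E P) rho /\
           orthogonal_states rho) /\
        (informative E P ->
           forall rho, maximizing_states (binary_capacity b E P) rho ->
             orthogonal_states rho)].
Proof.
split; [exact: prob_correct_maximizers | | exact: binary_capacity_maximizers].
move=> p dp; have [[rho [opt orth]] all_orth] := prob_correct_maximizers hE hP dp.
split; first by exists rho; split => //; apply/minimizing_prob_error.
by move=> inf p0 p1 s /minimizing_prob_error h; apply: all_orth => //; apply: h.
Qed.
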